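(* Let $X$ and $Y$ be separable real Banach spaces, $G\subset X$ an open set and $f:G\to Y$ a Lipschitz map. Then the set of irregular points of $f$ (the points of $G$ that are not regular points of $f$) is $\sigma$-porous.
   Context: For $x\in G$ and $v\in X$, $f'(x,v)=\lim_{t\to0}(f(x+tv)-f(x))/t$ when the limit exists. A point $x$ is a regular point of $f$ if for every $v\in X$ for which $f'(x,v)$ exists, $\lim_{t\to0}\frac{f(x+tu+tv)-f(x+tu)}{t}=f'(x,v)$ uniformly for $u\in X$ with $\|u\|\le1$. $B(z,r)$ is the closed ball with center $z$ and radius $r$. A set $A\subset X$ is porous if there is $0<c<1$ such that for every $x\in A$ there are $y_n\in X$ with $y_n\to x$ and $B(y_n,c\,\|y_n-x\|)\cap A=\emptyset$ for every $n$. A set is $\sigma$-porous if it is a union of countably many porous sets (the constant $c$ may vary from set to set). *)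

(* Defs.v *)
From HB Require Import structures.
From mathcomp Require Import all_boot all_order all_algebra.
From mathcomp Require Import all_classical all_reals all_analysis.

Set Implicit Arguments.
Unset Strict Implicit.
Unset Printing Implicit Defensive.

Import Order.TTheory GRing.Theory Num.Theory.
Import numFieldNormedType.Exports.

Local Open Scope classical_set_scope.
Local Open Scope ring_scope.

Definition separable (T : topologicalType) : Prop :=
  exists2 D : set T, countable D & dense D.

(* A map f : G -> Y on an open set G is represented by a total function X -> Y.
   For x in G the condition below only involves the germ of f at x, so the
   values of f outside G are irrelevant. The limits are along 0^', i.e. t tends
   to 0 from both sides with t != 0; 'D_v f x is the limit f'(x, v), and
   [derivable f x v] says that it exists. *)
Definition regular_point (R : realType) (X Y : normedModType R)
    (f : X -> Y) (x : X) : Prop :=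
  forall v : X, derivable f x v ->
    {uniform [set u : X | `|u| <= 1],
      (fun (t : R) (u : X) =>
         t^-1 *: (f (x + t *: u + t *: v) - f (x + t *: u))) @ 0^' -->
      (fun _ : X => 'D_v f x)}.

Definition irregular_points (R : realType) (X Y : normedModType R)
    (G : set X) (f : X -> Y) : set X :=
  [set x | G x /\ ~ regular_point f x].

(* [closed_ball_ Num.norm z r] is [set y | `|z - y| <= r]. The other library
   ball, [closed_ball z r], is the closure of the open ball, hence empty for
   r = 0; with it the constant sequence y n = x would make every set porous. *)
Definition porous (R : realType) (X : normedModType R) (A : set X) : Prop :=
  exists c : R, [/\ 0 < c, c < 1 &
    forall x : X, A x ->
      exists y : nat -> X, y @ \oo --> x /\
        forall n, closed_ball_ Num.norm (y n) (c * `|y n - x|) `&` A = set0].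

Definition sigma_porous (R : realType) (X : normedModType R) (A : set X) :
    Prop :=
  exists F : nat -> set X, (forall n, porous (F n)) /\ A = \bigcup_n F n.

(* Main.v *)
(** Near an irregular point x the increments f(z + tv) - f(z) are close to tw at
    z = x, for all small t, but stay at distance more than 2e|t| from tw at
    points z = x + tu with |u| <= 1 and t arbitrarily small.  The Lipschitz
    condition spreads the latter behaviour over a ball around x + tu of radius
    proportional to |t|, which therefore contains no point where the increments
    are within e|t| of tw.  By separability the direction v, the vector w and
    the scales can be taken from a countable family. *)
Require Import Defs.
From HB Require Import structures.
From mathcomp Require Import all_boot all_order all_algebra.
From mathcomp Require Import all_classical all_reals all_analysis.
From mathcomp Require Import lra.

Import Order.TTheory GRing.Theory Num.Theory.
Import numFieldNormedType.Exports.

Local Open Scope classical_set_scope.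
Local Open Scope ring_scope.

Lemma separable_dense_seq {R : realType} {X : normedModType R} :
  separable X ->
  exists e : nat -> X, forall x eps, 0 < eps -> exists n, `|x - e n| < eps.
Proof.
case=> D /countable_injP[g ginj] Ddense.
(* This sequence inverts the injection [g] of [D] into the naturals. At a number that is not a code
   it takes the junk value 0, harmless because the sequence need not stay in [D]. *)
exists (fun n => xget 0 [set d | D d /\ g d = n]) => x eps eps0.
have [||d [xd Dd]] := Ddense (ball x eps).
- by exists x; exact: ballxx.
- exact: ball_open.
exists (g d); case: xgetP => [d' _ [Dd' gd']|/(_ d)]; last by case.
by rewrite (ginj _ _ _ _ gd') ?inE //; rewrite -ball_normE in xd.
Qed.

Lemma porous0 {R : realType} {X : normedModType R} : @porous R X set0.
Proof. by exists 2^-1; split=> //; lra. Qed.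

Lemma sigma_porous_bigcup_countType {R : realType} {X : normedModType R}
    {I : countType} {F : I -> set X} :
  (forall i, porous (F i)) -> sigma_porous (\bigcup_i F i).
Proof.
(* Numbers that decode to no index contribute the empty set, which is vacuously porous. *)
move=> pF; exists (fun n => if unpickle n is Some i then F i else set0).
split=> [n|]; first by case: unpickle => [i|]; [exact: pF | exact: porous0].
apply/seteqP; split=> x.
  by case=> i _ Fx; exists (pickle i) => //; rewrite pickleK.
by case=> n _; case: unpickle => // i Fx; exists i.
Qed.

(** Here [w] is the derivative ['D_v f x]. The first estimate is its existence and the second the
    failure of uniform convergence, both multiplied by [t] so that no quotient remains. *)
Lemma irregular_witness {R : realType} {X Y : normedModType R}
    {f : X -> Y} {x : X} : ~ regular_point f x ->
  exists v w eps, [/\ 0 < eps,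
    forall e, 0 < e -> exists2 d, 0 < d & forall t, `|t| < d ->
      `|f (x + t *: v) - f x - t *: w| <= e * `|t| &
    forall d, 0 < d -> exists t u, [/\ 0 < `|t|, `|t| < d, `|u| <= 1 &
      eps * `|t| < `|f (x + t *: u + t *: v) - f (x + t *: u) - t *: w|] ].
Proof.
have scale t (a w : Y) : t != 0 -> `|w - t^-1 *: a| = `|t|^-1 * `|a - t *: w|.
  move=> t0; rewrite -normrV ?unitfE // -normrZ scalerBr scalerK //.
  exact: distrC.
move=> /existsNP[v /not_implyP[dfv nunif]]; exists v, ('D_v f x).
have [eps eps0 nreg] : exists2 eps, 0 < eps &
    forall d, 0 < d -> exists t u, [/\ 0 < `|t|, `|t| < d, `|u| <= 1 &
      eps * `|t| <
      `|f (x + t *: u + t *: v) - f (x + t *: u) - t *: 'D_v f x|].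
  apply: contrapT => noeps; apply: nunif => P /uniform_nbhs[E [entE EP]].
  have [eps /= eps0 epsE] : exists2 eps : R, 0 < eps &
      forall a b : Y, `|a - b| < eps -> E (a, b).
    move: entE; rewrite -entourage_ballE => -[eps /= eps0 sub].
    exists eps => // a b ab; apply: sub => /=.
    by rewrite -ball_normE.
  (* Negating the strict inequality leaves a bound with [<=]; halving [eps] restores the strict one
     that the entourage requires. *)
  move/forall2NP : noeps => /(_ (eps / 2)) [|/existsNP[d /not_implyP[d0 nd]]].
    by case; exact: divr_gt0.
  apply/nbhs_ballP; exists d => //= t; rewrite -ball_normE /= sub0r normrN => td t0.
  apply: EP => u /= u1; apply: epsE; rewrite scale //.
  rewrite mulrC ltr_pdivrMr ?normr_gt0 //.
  apply: (@le_lt_trans _ _ (eps / 2 * `|t|)); last first.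
    by rewrite ltr_pM2r ?normr_gt0 //; lra.
  rewrite leNgt; apply/negP => h; apply: nd; exists t, u.
  by rewrite normr_gt0.
exists eps; split=> // e e0.
have /cvgrPdist_le/(_ e e0)/nbhs_ballP[d /= d0 dP] := dfv.
exists d => // t td; have [->|t0] := eqVneq t 0.
  by rewrite !scale0r addr0 !subrr !normr0 mulr0.
have := dP t; rewrite -ball_normE /= sub0r normrN => /(_ td t0).
by rewrite -/(derive f x v) scale // mulrC ler_pdivrMr ?normr_gt0 // [t *: v + x]addrC.
Qed.

(** The factor 2 leaves a gap of [e * |t|] between the two conditions, the room that the Lipschitz
    estimate consumes. The scale [r] is fixed so that the first condition holds uniformly over the
    set. *)
Definition uneven_points {R : realType} {X Y : normedModType R} (f : X -> Y)
    (r e : R) (v : X) (w : Y) : set X :=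
  [set x | (forall t, `|t| < r ->
              `|f (x + t *: v) - f x - t *: w| <= e * `|t|) /\
           forall d, 0 < d -> exists t u, [/\ 0 < `|t|, `|t| < d, `|u| <= 1 &
             2 * e * `|t| <
             `|f (x + t *: u + t *: v) - f (x + t *: u) - t *: w|] ].

Lemma porous_uneven_points {R : realType} {X Y : normedModType R}
    {G : set X} {f : X -> Y} {L r e : R} {v : X} {w : Y} {A : set X} :
  open G -> 0 < L ->
  (forall a b, G a -> G b -> `|f a - f b| <= L * `|a - b|) ->
  0 < r -> 0 < e -> A `<=` G `&` uneven_points f r e v w -> porous A.
Proof.
(* The term [2 * L] gives [2 * c * L <= e]; the term [2 * e] forces [c < 1]. *)
move=> openG L0 lipf r0 e0 AG; pose c := e / (2 * e + 2 * L).
have den0 : 0 < 2 * e + 2 * L by lra.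
have c0 : 0 < c by exact: divr_gt0.
have c1 : c < 1 by rewrite ltr_pdivrMr //; lra.
have cL : 2 * (c * L) <= e.
  have : c * (2 * e + 2 * L) = e by rewrite divfK // gt_eqF.
  by have := mulr_gt0 c0 e0; lra.
exists c; split=> // x Ax.
have [Gx [_ xuneven]] := AG _ Ax.
have [rho /= rho0 rhoG] : exists2 rho : R, 0 < rho & ball x rho `<=` G.
  by apply/nbhs_ballP; exact: open_nbhs_nbhs.
have v3 : 0 < 2 + `|v| by have := normr_ge0 v; lra.
have /choice[y yP] (n : nat) : exists y : X,
    `|y - x| < n.+1%:R^-1 /\ closed_ball_ Num.norm y (c * `|y - x|) `&` A = set0.
  (* The three bounds on [|t|] serve, in order, to apply the first condition at a point [z] of [A],
     to keep [x + tu], [z] and their translates by [tv] in [G], and to make the centres [x + tu]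
     converge to [x]. *)
  have [|t [u [t0 td u1 tu]]] :=
    xuneven (Order.min r (Order.min (rho / (2 + `|v|)) n.+1%:R^-1)).
    by rewrite !lt_min r0 divr_gt0 // invr_gt0 ltr0n.
  move: td; rewrite !lt_min => /and3P[tr trho tn].
  have yx : `|x + t *: u - x| <= `|t|.
    by rewrite addrC addKr normrZ ler_piMr.
  exists (x + t *: u); split; first exact: le_lt_trans tn.
  apply/seteqP; split=> // z [/= yz /AG[Gz [zt _]]].
  have {}yz : `|x + t *: u - z| <= c * `|t|.
    by apply: le_trans yz _; rewrite ler_pM2l.
  move: trho; rewrite ltr_pdivlMr // => trho.
  have inG a : `|a - x| <= `|t| * (2 + `|v|) -> G a.
    move=> ax; apply: rhoG; rewrite -ball_normE /= distrC.
    exact: le_lt_trans trho.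
  have tv0 : 0 <= `|t| * `|v| by exact: mulr_ge0.
  have Gy : G (x + t *: u) by apply: inG; lra.
  have Gyv : G (x + t *: u + t *: v).
    apply: inG; rewrite addrAC; apply: le_trans (ler_normD _ _) _.
    by rewrite [`|t *: v|]normrZ; lra.
  have ct : c * `|t| <= `|t| by rewrite ler_piMl // ltW.
  have Gzv : G (z + t *: v).
    apply: inG.
    have -> : z + t *: v - x = (x + t *: u - x) - (x + t *: u - z) + t *: v.
      by rewrite opprB [X in _ = X + _]addrC subrKA addrAC.
    apply: le_trans (ler_normD _ _) _; rewrite [`|t *: v|]normrZ.
    by have := ler_normB (x + t *: u - x) (x + t *: u - z); lra.
  have l1 := lipf _ _ Gy Gz.
  have l2 := lipf _ _ Gyv Gzv.
  have yzv : x + t *: u + t *: v - (z + t *: v) = x + t *: u - z.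
    by rewrite opprD addrACA subrr addr0.
  rewrite yzv in l2.
  have l3 : L * `|x + t *: u - z| <= L * (c * `|t|) by rewrite ler_pM2l.
  have l4 := zt t tr.
  have l5 : 2 * (c * L) * `|t| <= e * `|t| by rewrite ler_pM2r.
  move: tu; set p := f _; set q := f (x + _) in l1 *.
  (* Each of the first two differences is at most [L * c * |t|] and the last term at most [e * |t|],
     so the sum is at most [2 * e * |t|], against the choice of [t] and [u]. *)
  have -> : p - q - t *: w = (p - f (z + t *: v)) - (q - f z)
                             + (f (z + t *: v) - f z - t *: w).
    by rewrite opprB addrACA subrKA addrA subrKA.
  have := ler_normD ((p - f (z + t *: v)) - (q - f z))
                    (f (z + t *: v) - f z - t *: w).
  have := ler_normB (p - f (z + t *: v)) (q - f z).
  by rewrite -/p in l2; lra.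
exists y; split=> [|n]; last by case: (yP n).
apply/cvgrPdist_lt => d d0; near=> n; rewrite distrC.
apply: lt_trans (yP n).1 _; near: n; exact: near_infty_natSinv_lt (PosNum d0).
Unshelve. all: end_near. Qed.

Theorem proposition3p3 (R : realType) (X Y : completeNormedModType R)
    (separableX : separable X) (separableY : separable Y)
    (G : set X) (openG : open G)
    (f : X -> Y) (lipf : [lipschitz f x | x in G]) :
  sigma_porous (irregular_points G f).
Proof.
have [L L0 {}lipf] : exists2 L : R, 0 < L &
    forall a b, G a -> G b -> `|f a - f b| <= L * `|a - b|.
  (* The hypothesis provides the bound for every constant strictly above [M]; the maximum with 1
     makes the constant positive. *)
  have [M [_ MP]] := lipf; exists (Num.max 1 (M + 1)).
    by rewrite lt_max ltr01.
  move=> a b Ga Gb; apply: (MP _ _ (a, b)) => //.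
  by rewrite lt_max ltrDl ltr01 orbT.
have [eX eXP] := separable_dense_seq separableX.
have [eY eYP] := separable_dense_seq separableY.
have inv0 n : 0 < n.+1%:R^-1 :> R by rewrite invr_gt0 ltr0n.
(* The intersection makes the union equal to the irregular set, as [sigma_porous] demands, rather
   than merely cover it. *)
pose E (i : nat * nat * nat * nat) := irregular_points G f `&`
  uneven_points f i.1.1.1.+1%:R^-1 i.1.1.2.+1%:R^-1 (eX i.1.2) (eY i.2).
have -> : irregular_points G f = \bigcup_i E i; last first.
  apply: sigma_porous_bigcup_countType => i.
  apply: (porous_uneven_points openG L0 lipf (inv0 _) (inv0 _)).
  by move=> x [[Gx _] Ex]; split=> //; exact: Ex.
apply/seteqP; split=> [x irrx|x [i _ []]//].
have [Gx /irregular_witness[v [w [eps [eps0 dfx unev]]]]] := irrx.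
have [rho /= rho0 rhoG] : exists2 rho : R, 0 < rho & ball x rho `<=` G.
  by apply/nbhs_ballP; exact: open_nbhs_nbhs.
have small (a : R) : 0 < a -> exists n : nat, n.+1%:R^-1 < a.
  move=> a0; near \oo => n; exists n.
  by near: n; exact: near_infty_natSinv_lt (PosNum a0).
(* Passing from [v], [w] to [v'], [w'] will cost [2e/3 * |t|]. The upper bound becomes
   [e/3 + 2e/3 = e], and since [3e < eps] the lower one stays above [3e - 2e/3], hence above
   [2e]. *)
have [|p peps] := small (eps / 3); first by exact: divr_gt0.
have e0 := inv0 p; set e : R := p.+1%:R^-1 in peps e0.
have [j vj] := eXP v (e / 3 / L) ltac:(by rewrite !divr_gt0).
have [k wk] := eYP w (e / 3) ltac:(by rewrite divr_gt0).
set v' := eX j in vj; set w' := eY k in wk.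
have {}vj : L * `|v - v'| <= e / 3.
  by rewrite mulrC -ler_pdivlMr // ltW.
have compare z t : G (z + t *: v) -> G (z + t *: v') ->
    `|(f (z + t *: v) - f z - t *: w) - (f (z + t *: v') - f z - t *: w')|
    <= 2 * e / 3 * `|t|.
  move=> Gv Gv'; have := lipf _ _ Gv Gv'.
  rewrite opprD addrACA subrr add0r -scalerBr normrZ => lt.
  have -> : f (z + t *: v) - f z - t *: w - (f (z + t *: v') - f z - t *: w')
      = (f (z + t *: v) - f (z + t *: v')) - t *: (w - w').
    rewrite scalerBr [- (_ - _ - _)]opprD addrACA -opprD.
    by rewrite [- (f _ - f z)]opprB subrKA.
  apply: le_trans (ler_normB _ _) _; rewrite normrZ.
  have := ler_wpM2r (normr_ge0 t) vj.
  have := ler_wpM2r (normr_ge0 t) (ltW wk).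
  lra.
have vv0 : 0 < 1 + `|v| + `|v'|.
  by have := normr_ge0 v; have := normr_ge0 v'; lra.
(* For [|t| < d1] the points [x + tu + tv] and [x + tu + tv'] both lie in [G], as [compare]
   requires. *)
pose d1 := rho / (1 + `|v| + `|v'|).
have d10 : 0 < d1 by exact: divr_gt0.
have inG t u a : `|t| < d1 -> `|u| <= 1 -> `|a| <= `|v| + `|v'| ->
    G (x + t *: u + t *: a).
  rewrite ltr_pdivlMr // => td u1 av; apply: rhoG.
  rewrite -ball_normE /= distrC -(addrA x) [x + _]addrC addrK -scalerDr normrZ.
  apply: le_lt_trans td; rewrite ler_wpM2l //.
  by apply: le_trans (ler_normD _ _) _; lra.
have vle : `|v| <= `|v| + `|v'| by rewrite lerDl.
have v'le : `|v'| <= `|v| + `|v'| by rewrite lerDr.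
have [|d d0 dP] := dfx (e / 3); first exact: divr_gt0.
have [|q qd] := small (Order.min d d1); first by rewrite lt_min d0.
exists (q, p, j, k) => //; split=> //; split=> [t /= tq|h h0 /=].
  have := lt_trans tq qd; rewrite lt_min => /andP[td td1].
  have inG0 a : `|a| <= `|v| + `|v'| -> G (x + t *: a).
    move=> av; have := inG t 0 a td1; rewrite scaler0 addr0 normr0; exact.
  have := compare x t (inG0 _ vle) (inG0 _ v'le).
  have := dP t td; rewrite -/v' -/w' -/e.
  set P := _ - t *: w; set Q := _ - t *: w'.
  by have := ler_normB P (P - Q); rewrite subKr; lra.
have [|t [u [t0 td u1 tu]]] := unev (Order.min h d1); first by rewrite lt_min h0.
move: td; rewrite lt_min => /andP[th td1].
exists t, u; split=> //; rewrite -/v' -/w' -/e.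
have := compare (x + t *: u) t (inG _ _ _ td1 u1 vle) (inG _ _ _ td1 u1 v'le).
have : 3 * e * `|t| < eps * `|t| by rewrite ltr_pM2r //; lra.
move: tu; set P := _ - t *: w; set Q := _ - t *: w'.
have := ler_normD (P - Q) Q; rewrite subrK.
have := mulr_gt0 e0 t0; lra.
Unshelve. all: end_near. Qed.
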